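(* We have $$f_{0111}(x)=\frac{(1-x)^2-\sqrt{1-4x+2x^2+x^4}}{2x^2}$$ as formal power series in $x$, where $f_{0111}(x)=\sum_{n\ge 0} b_n(0111)x^n$ and $b_n(0111)$ is the number of ascent sequences of length $n$ that avoid both patterns $021$ and $0111$.
   Context: For a finite sequence $w=w_1\cdots w_n$ of integers, $\mathrm{asc}(w)$ is the number of indices $1\le i\le n-1$ with $w_i<w_{i+1}$. An ascent sequence of length $n\ge 1$ is a sequence $a_1\cdots a_n$ of non-negative integers such that $a_1=0$ and $a_i\le \mathrm{asc}(a_1\cdots a_{i-1})+1$ for $1<i\le n$; there is exactly one (empty) ascent sequence of length $0$. A sequence $\pi=\pi_1\cdots\pi_n$ contains a pattern $\tau=\tau_1\cdots\tau_m$ if there are indices $1\le i_1<\cdots<i_m\le n$ such that for all $j,k\in\{1,\dots,m\}$: $\pi_{i_j}<\pi_{i_k}$ iff $\tau_j<\tau_k$, and $\pi_{i_j}=\pi_{i_k}$ iff $\tau_j=\tau_k$; otherwise $\pi$ avoids $\tau$. For a pattern $\tau$, $B_n(\tau)$ is the set of ascent sequences of length $n$ avoiding both $021$ and $\tau$ (with $B_0(\tau)$ consisting of the empty sequence), and $b_n(\tau)=|B_n(\tau)|$. The square root denotes the formal power series square root with constant term $1$. *)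

(* Defs.v *)
From HB Require Import structures.
From mathcomp Require Import all_boot all_order all_algebra.
From mathcomp Require Import finmap boolp classical_sets functions cardinality.

Set Implicit Arguments.
Unset Strict Implicit.
Unset Printing Implicit Defensive.

Import Order.TTheory GRing.Theory Num.Theory.

Local Open Scope ring_scope.

Record fps (R : Type) := FPS { coefs :> nat -> R }.

HB.instance Definition _ (R : Type) := gen_eqMixin (fps R).
HB.instance Definition _ (R : Type) := gen_choiceMixin (fps R).

Lemma fpsP (R : Type) (p q : fps R) : coefs p =1 coefs q <-> p = q.
Proof.
by split=> [|-> //]; case: p q => [p] [q] /= /funext ->.
Qed.

Section FpsRing.
Variable R : fieldType.
Implicit Types p q r : fps R.

Definition fps_zero : fps R := FPS (fun=> 0).
Definition fps_opp p : fps R := FPS (fun n => - p n).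
Definition fps_add p q : fps R := FPS (fun n => p n + q n).

Fact fps_addA : associative fps_add.
Proof. by move=> p q r; apply/fpsP => n /=; rewrite addrA. Qed.
Fact fps_addC : commutative fps_add.
Proof. by move=> p q; apply/fpsP => n /=; rewrite addrC. Qed.
Fact fps_add0 : left_id fps_zero fps_add.
Proof. by move=> p; apply/fpsP => n /=; rewrite add0r. Qed.
Fact fps_addN : left_inverse fps_zero fps_opp fps_add.
Proof. by move=> p; apply/fpsP => n /=; rewrite addNr. Qed.

HB.instance Definition _ :=
  GRing.isZmodule.Build (fps R) fps_addA fps_addC fps_add0 fps_addN.

Definition fps_one : fps R := FPS (fun n => (n == 0)%:R).
Definition fps_mul p q : fps R :=
  FPS (fun n => \sum_(i < n.+1) p i * q (n - i)%N).

Definition fps_trunc m p : {poly R} := \poly_(i < m) p i.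

Fact fps_mul_trunc m n p q : (n < m)%N ->
  fps_mul p q n = (fps_trunc m p * fps_trunc m q)`_n.
Proof.
move=> ltnm; rewrite coefM /=; apply: eq_bigr => i _.
rewrite !coef_poly (leq_ltn_trans (leq_ord i) ltnm).
by rewrite (leq_ltn_trans (leq_subr i n) ltnm).
Qed.

Fact fps_mulC : commutative fps_mul.
Proof.
by move=> p q; apply/fpsP => n; rewrite !(@fps_mul_trunc n.+1) // mulrC.
Qed.

Fact fps_mulA : associative fps_mul.
Proof.
move=> p q r; apply/fpsP => n.
set tp := fps_trunc n.+1 p; set tq := fps_trunc n.+1 q.
set tr := fps_trunc n.+1 r.
transitivity ((tp * (tq * tr))`_n).
  rewrite coefM; apply: eq_bigr => i _.
  rewrite (@fps_mul_trunc n.+1) ?ltnS ?leq_subr //.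
  by rewrite coef_poly ltn_ord.
rewrite mulrA coefM; apply: eq_bigr => i _.
rewrite (@fps_mul_trunc n.+1) ?ltn_ord //.
by rewrite [tr`_ _]coef_poly ltnS leq_subr.
Qed.

Fact fps_mul1 : left_id fps_one fps_mul.
Proof.
move=> p; apply/fpsP => n /=.
rewrite big_ord_recl /= mul1r subn0 big1 ?addr0 // => i _.
by rewrite mul0r.
Qed.

Fact fps_mulDl : left_distributive fps_mul fps_add.
Proof.
move=> p q r; apply/fpsP => n /=; rewrite -big_split /=.
by apply: eq_bigr => i _; rewrite mulrDl.
Qed.

Fact fps_one_neq0 : fps_one != fps_zero.
Proof. by apply/eqP => /fpsP/(_ 0)/eqP; rewrite /= oner_eq0. Qed.

HB.instance Definition _ :=
  GRing.Zmodule_isComNzRing.Build (fps R)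
    fps_mulA fps_mulC fps_mul1 fps_mulDl fps_one_neq0.

Definition fps_unit : pred (fps R) := fun p => `[< exists q, q * p = 1 >].
Definition fps_inv p : fps R :=
  if pselect (exists q, q * p = 1) is left e then sval (cid e) else p.

Fact fps_mulV : {in fps_unit, left_inverse 1 fps_inv *%R}.
Proof.
move=> p /asboolP pU; rewrite /fps_inv; case: pselect => // e.
by case: cid.
Qed.
Fact fps_unitP p q : q * p = 1 -> fps_unit p.
Proof. by move=> qp1; apply/asboolP; exists q. Qed.
Fact fps_inv_out : {in [predC fps_unit], fps_inv =1 id}.
Proof.
move=> p /negP pU; rewrite /fps_inv; case: pselect => // e.
by case: pU; apply/asboolP.
Qed.

HB.instance Definition _ :=
  GRing.ComNzRing_hasMulInverse.Build (fps R) fps_mulV fps_unitP fps_inv_out.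

Lemma fps_coef0 n : (0 : fps R) n = 0. Proof. by []. Qed.
Lemma fps_coef1 n : (1 : fps R) n = (n == 0)%:R. Proof. by []. Qed.
Lemma fps_coefN p n : (- p) n = - p n. Proof. by []. Qed.
Lemma fps_coefD p q n : (p + q) n = p n + q n. Proof. by []. Qed.
Lemma fps_coefM p q n : (p * q) n = \sum_(i < n.+1) p i * q (n - i)%N.
Proof. by []. Qed.

Fact fps_neq0 p : p != 0 ->
  exists2 m, p m != 0 & forall i, (i < m)%N -> p i = 0.
Proof.
move=> /eqP p0.
have pn : exists n, p n != 0.
  apply: contrapT => pn; apply: p0; apply/fpsP => n.
  by apply/eqP; apply: contrapT => /negP ?; apply: pn; exists n.
case: (ex_minnP pn) => m pm min; exists m => // i im.
by apply/eqP; apply: contraTT im => pi0; rewrite -leqNgt min.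
Qed.

Fact fps_idomain : GRing.integral_domain_axiom (fps R).
Proof.
move=> p q pq0; apply/norP => -[/fps_neq0[m pm lt_m] /fps_neq0[n qn lt_n]].
move/fpsP/(_ (m + n)%N)/eqP: pq0; rewrite fps_coefM fps_coef0.
have mlt : (m < (m + n).+1)%N by rewrite ltnS leq_addr.
rewrite (bigD1 (Ordinal mlt)) //= addKn big1 ?addr0.
  by rewrite mulf_eq0 (negbTE pm) (negbTE qn).
move=> i /eqP im; have [lti|] := ltnP i m; first by rewrite lt_m ?mul0r.
rewrite leq_eqVlt => /orP[/eqP mi|lti]; first by case: im; apply: val_inj.
by rewrite [q _]lt_n ?mulr0 // ltn_subLR ?ltn_add2r // leq_ord.
Qed.

HB.instance Definition _ :=
  GRing.ComUnitRing_isIntegral.Build (fps R) fps_idomain.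

Definition fpsX : fps R := FPS (fun n => (n == 1)%:R).

(** The coefficients of the square root s with s_0 = 1 of a series p with
    p_0 = 1 are forced by p_m = 2 s_m + \sum_(0 < k < m) s_k s_(m - k). *)
Fixpoint fps_sqrt_prefix p n : seq R :=
  if n is m.+1 then
    let s := fps_sqrt_prefix p m in
    rcons s (if m == 0 then 1
             else (p m - \sum_(1 <= k < m) s`_k * s`_(m - k)) / 2%:R)
  else [::].

(** Meaningful only for p_0 = 1 in characteristic other than 2. *)
Definition fps_sqrt p : fps R := FPS (fun n => (fps_sqrt_prefix p n.+1)`_n).

Fact size_fps_sqrt_prefix p n : size (fps_sqrt_prefix p n) = n.
Proof. by elim: n => //= n IHn; rewrite size_rcons IHn. Qed.

Fact nth_fps_sqrt_prefix p n i : (i < n)%N ->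
  (fps_sqrt_prefix p n)`_i = fps_sqrt p i.
Proof.
elim: n => // n IHn; rewrite ltnS leq_eqVlt => /orP[/eqP -> //|ltin].
by rewrite /= nth_rcons size_fps_sqrt_prefix ltin IHn.
Qed.

Lemma fps_sqrt0 p : fps_sqrt p 0 = 1. Proof. by []. Qed.

Lemma fps_sqrtK p : (2%:R : R) != 0 -> p 0 = 1 -> fps_sqrt p ^+ 2 = p.
Proof.
move=> nz2 p0; have s0 := fps_sqrt0 p.
have sS m : fps_sqrt p m.+1 = (p m.+1 -
    \sum_(1 <= k < m.+1) fps_sqrt p k * fps_sqrt p (m.+1 - k)%N) / 2%:R.
  have -> : fps_sqrt p m.+1 =
      (rcons (fps_sqrt_prefix p m.+1) ((p m.+1 - \sum_(1 <= k < m.+1)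
         (fps_sqrt_prefix p m.+1)`_k * (fps_sqrt_prefix p m.+1)`_(m.+1 - k))
         / 2%:R))`_m.+1 by [].
  rewrite nth_rcons size_fps_sqrt_prefix ltnn eqxx.
  congr ((_ - _) / _); apply: eq_big_nat => k /andP[k0 km].
  rewrite !nth_fps_sqrt_prefix // ltn_subLR ?(ltnW km) //.
  by rewrite -[ltnLHS]add0n ltn_add2r.
move: (fps_sqrt p) s0 sS => s s0 sS; apply/fpsP => -[|m].
  by rewrite expr2 fps_coefM big_ord1 s0 mulr1 p0.
rewrite expr2 fps_coefM big_ord_recl big_ord_recr /= subn0 subnn s0.
rewrite mul1r mulr1 addrCA [bump 0 m]add1n sS -[X in _ + X]mulr2n -[X in _ + X]mulr_natr divfK //.
by rewrite big_add1 big_mkord addrC subrK.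
Qed.

Lemma fps_sqrt_uniq p s : (2%:R : R) != 0 ->
  s ^+ 2 = p -> s 0 = 1 -> s = fps_sqrt p.
Proof.
move=> nz2 sp s0.
have p0 : p 0 = 1 by rewrite -sp expr2 fps_coefM big_ord1 /= s0 mulr1.
move/eqP: sp; rewrite -{1}(fps_sqrtK nz2 p0) eqf_sqr => /orP[/eqP //|/eqP sN].
have := s0; rewrite sN fps_coefN fps_sqrt0 => /eqP.
by rewrite eq_sym -addr_eq0 -mulr2n (negbTE nz2).
Qed.

End FpsRing.

(** A power series seen in the field of fractions of the ring of power series,
    where division by a series with zero constant term makes sense. *)
Notation "p %:F" := (FracField.tofrac p) : ring_scope.

Local Open Scope nat_scope.

Definition asc (w : seq nat) : nat :=
  count (fun i => nth 0 w i < nth 0 w i.+1) (iota 0 (size w).-1).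

(** Indices start at 0 here; the empty sequence satisfies both conditions. *)
Definition ascent_seq (a : seq nat) : bool :=
  (nth 0 a 0 == 0) &&
  all (fun i => nth 0 a i <= asc (take i a) + 1) (iota 1 (size a).-1).

Definition contains (w t : seq nat) : bool :=
  [exists f : {ffun 'I_(size t) -> 'I_(size w)},
    [forall j : 'I_(size t), forall k : 'I_(size t),
      [&& (j < k) ==> (f j < f k),
          (nth 0 w (f j) < nth 0 w (f k)) == (nth 0 t j < nth 0 t k)
        & (nth 0 w (f j) == nth 0 w (f k)) == (nth 0 t j == nth 0 t k)]]].

Definition avoids (w t : seq nat) : bool := ~~ contains w t.

Definition B (t : seq nat) (n : nat) : set (seq nat) :=
  [set a | [/\ size a = n, ascent_seq a, avoids a [:: 0; 2; 1] & avoids a t]]%classic.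

Lemma asc_le_size w : asc w <= (size w).-1.
Proof. by rewrite -[leqRHS](size_iota 0) count_size. Qed.

Lemma ascent_seq_le a i : ascent_seq a -> i < size a -> nth 0 a i <= i.
Proof.
move=> /andP[/eqP a0 /allP aP]; case: i => [|i] ltia; first by rewrite a0.
have lti : i.+1 \in iota 1 (size a).-1.
  by rewrite mem_iota /= add1n prednK // (leq_ltn_trans _ ltia).
apply: leq_trans (aP _ lti) _; rewrite addn1 ltnS.
by rewrite (leq_trans (asc_le_size _)) // size_takel // ltnW.
Qed.

Lemma finite_B t n : finite_set (B t n).
Proof.
pose F (u : n.-tuple 'I_n.+1) : seq nat := map val u.
apply: (@sub_finite_set _ _ (range F)); last exact: finite_image.
move=> a [sza aP _ _].
have szI : size (map (@inord n) a) == n by rewrite size_map sza.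
exists (Tuple szI) => //; rewrite /F /= -map_comp map_id_in // => x xa /=.
rewrite inordK // ltnS -(nth_index 0 xa).
have ltx : index x a < size a by rewrite index_mem.
by rewrite (leq_trans (ascent_seq_le aP ltx)) // -sza ltnW.
Qed.

(** [fset_set] is the finite set underlying a finite classical set (see
    [finite_B]), so that this is the cardinality of [B t n]. *)
Definition b (t : seq nat) (n : nat) : nat := #|` fset_set (B t n)|%fset.

Definition genfun (t : seq nat) : fps rat := FPS (fun n => ((b t n)%:R)%R).

(* Main.v *)
Require Import Defs.
From mathcomp Require Import all_boot all_order all_algebra.
From mathcomp Require Import finmap boolp classical_sets functions cardinality.
From mathcomp Require Import zify ring.

(** An ascent sequence avoids 021 iff its nonzero letters weakly increase, and
    it then avoids 0111 iff moreover each nonzero letter occurs at most twice.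
    Hence the number of ways to extend such a sequence by [n] letters depends
    only on [t = asc - max] and on whether the maximum may still be repeated,
    and if so whether the last letter is 0 (repeating then makes an ascent).
    A new maximum moves [t] to any of [0, ..., t]; repeating the maximum after
    a 0 moves [t] to [t + 1]. The resulting linear system for the generating
    functions of the extensions has solutions proportional to
    [(1 - x)^t u^(t + 1)], where [u] is the power series root of
    [u = 1 + (2 x + x^2) u + x^3 u^2], and the generating function sought is
    [1 + x u]. *)

Set Implicit Arguments.
Unset Strict Implicit.
Unset Printing Implicit Defensive.

Import GRing.Theory Num.Theory.
Local Open Scope nat_scope.

(** * Pattern occurrences as subsequences *)

Lemma containsP (w t : seq nat) :
  reflect (exists2 u, subseq u w & size u = size t /\
             forall j k, j < size t -> k < size t ->
               (nth 0 u j < nth 0 u k) = (nth 0 t j < nth 0 t k) /\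
               (nth 0 u j == nth 0 u k) = (nth 0 t j == nth 0 t k))
          (contains w t).
Proof.
apply: (iffP existsP) => [[f /forallP fP]|[u uw [szu uP]]].
- have {}fP (j k : 'I_(size t)) : [/\ j < k -> f j < f k,
      (nth 0 w (f j) < nth 0 w (f k)) = (nth 0 t j < nth 0 t k)
    & (nth 0 w (f j) == nth 0 w (f k)) = (nth 0 t j == nth 0 t k)].
    by have /forallP/(_ k)/and3P[/implyP ? /eqP ? /eqP ?] := fP j.
  set s := [seq val (f j) | j <- enum 'I_(size t)].
  have szs : size s = size t by rewrite size_map size_enum_ord.
  have nths (j : 'I_(size t)) : nth 0 s j = f j.
    by rewrite (nth_map j) ?size_enum_ord // nth_ord_enum.
  have sorts : sorted ltn s.
    rewrite sorted_pairwise; last exact: ltn_trans.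
    apply/(pairwiseP 0) => i j; rewrite !inE szs => lti ltj ltij.
    rewrite (nths (Ordinal lti)) (nths (Ordinal ltj)).
    by have [/(_ ltij)] := fP (Ordinal lti) (Ordinal ltj).
  have subs : subseq s (iota 0 (size w)).
    have -> : s = filter (mem s) (iota 0 (size w)).
      apply: (irr_sorted_eq ltn_trans ltnn) => //.
        by apply: sorted_filter; [exact: ltn_trans | exact: iota_ltn_sorted].
      move=> i; rewrite mem_filter mem_iota /= add0n.
      case: (boolP (i \in s)) => [/mapP[j _ ->]|//].
      by rewrite ltn_ord.
    exact: filter_subseq.
  exists [seq nth 0 w i | i <- s].
    by rewrite -[X in subseq _ X](take_size w) -(map_nth_iota0 0) // map_subseq.
  split=> [|j k ltj ltk]; first by rewrite size_map.
  rewrite !(nth_map 0) ?szs // (nths (Ordinal ltj)) (nths (Ordinal ltk)).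
  by have [_ -> ->] := fP (Ordinal ltj) (Ordinal ltk).
- have /subseqP[m szm defu] := uw.
  (* The mask that cuts [u] out of [w], applied to the list of positions, gives the indices of the
     occurrence. *)
  set s := mask m (iota 0 (size w)).
  have us : u = [seq nth 0 w i | i <- s].
    by rewrite map_mask map_nth_iota0 // take_size.
  have szs : size s = size t by rewrite -szu us size_map.
  have lts (j : 'I_(size t)) : nth 0 s j < size w.
    have : nth 0 s j \in s by rewrite mem_nth ?szs.
    by move=> /mem_mask; rewrite mem_iota.
  have sorts : sorted ltn s.
    by apply: sorted_mask; [exact: ltn_trans | exact: iota_ltn_sorted].
  have nthu (j : 'I_(size t)) : nth 0 w (nth 0 s j) = nth 0 u j.
    by rewrite us (nth_map 0) ?szs.
  exists [ffun j => Ordinal (lts j)].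
  apply/forallP => j; apply/forallP => k; rewrite !ffunE /= !nthu.
  have [-> ->] := uP j k (ltn_ord j) (ltn_ord k); rewrite !eqxx !andbT.
  apply/implyP => jk; apply: (sorted_ltn_nth ltn_trans) => //;
    by rewrite inE szs.
Qed.

Lemma contains021P (w : seq nat) :
  reflect (exists a b c, subseq [:: a; b; c] w /\ a < c < b)
          (contains w [:: 0; 2; 1]).
Proof.
apply: (iffP (containsP _ _)) => [[u uw [szu uP]]|[a [b [c [sw abc]]]]].
  case: u szu uw uP => [|a [|b [|c []]]] //= _ uw uP; exists a, b, c.
  by have [] := uP 0 2 isT isT; have [] := uP 2 1 isT isT => /= -> _ ->.
exists [:: a; b; c] => //; split=> // j k.
by case: j => [|[|[|]]] //; case: k => [|[|[|]]] //= _ _; lia.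
Qed.

Lemma contains0111P (w : seq nat) :
  reflect (exists a b, subseq [:: a; b; b; b] w /\ a < b)
          (contains w [:: 0; 1; 1; 1]).
Proof.
apply: (iffP (containsP _ _)) => [[u uw [szu uP]]|[a [b [sw ab]]]].
  case: u szu uw uP => [|a [|b [|c [|d []]]]] //= _ uw uP.
  have [] := uP 0 1 isT isT; have [] := uP 1 2 isT isT.
  have [] := uP 1 3 isT isT => /= _ /eqP bd _ /eqP bc ab _.
  by exists a, b; split; rewrite // [X in [:: _; _; X; _]]bc [X in [:: _; _; _; X]]bd.
exists [:: a; b; b; b] => //; split=> // j k.
by case: j => [|[|[|[|]]]] //; case: k => [|[|[|[|]]]] //= _ _; lia.
Qed.

(** * Avoidance for words that start with 0 *)

Definition positives (w : seq nat) := [seq v <- w | 0 < v].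

Lemma positives_rcons w v :
  positives (rcons w v) = if 0 < v then rcons (positives w) v else positives w.
Proof. by rewrite /positives filter_rcons. Qed.

(** The leading 0 completes any descent among the positive letters to 021; conversely, the letters
    in the roles of 2 and 1 exceed another letter, so they are positive. *)
Lemma avoids021E w : avoids (0 :: w) [:: 0; 2; 1] = sorted leq (positives w).
Proof.
rewrite sorted_pairwise; last exact: leq_trans.
apply/idP/idP => [av|sortw]; last first.
  apply/contains021P => -[a [b [c [sub /andP[ac cb]]]]].
  have bc : subseq [:: b; c] w.
    by move: sub => /=; case: ifP => _ // /(subseq_trans (subseq_cons _ _)).
  have : subseq [:: b; c] (positives w).
    by rewrite subseq_filter bc /= (leq_ltn_trans _ ac) ?(leq_ltn_trans _ cb).
  move=> /subseq_pairwise/(_ sortw); rewrite /= andbT.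
  by rewrite andbT leqNgt cb.
apply: contraR av => H.
have {H} [b [c [bc cb]]] : exists b c, subseq [:: b; c] (positives w) /\ c < b.
  elim: (positives w) H => //= x s IHs; rewrite negb_and => /orP[/allPn[y ys]|/IHs].
    by rewrite -ltnNge => yx; exists x, y; rewrite eqxx sub1seq.
  by move=> [b [c [bc cb]]]; exists b, c; split=> //;
    apply: subseq_trans bc (subseq_cons _ _).
apply/contains021P; exists 0, b, c; split; last first.
  have : c \in positives w by apply: (mem_subseq bc); rewrite !inE eqxx orbT.
  by rewrite mem_filter cb andbT => /andP[].
by apply: (subseq_trans bc); apply: filter_subseq.
Qed.

(** The leading 0 completes three copies of a positive letter to 0111; conversely, the repeated
    letter exceeds another one, so it is positive and its copies lie in [w]. *)
Lemma avoids0111P w :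
  reflect (forall v, 0 < v -> count_mem v w <= 2)
          (avoids (0 :: w) [:: 0; 1; 1; 1]).
Proof.
apply: (iffP idP) => [av v v0|cnt].
  rewrite leqNgt; apply: contra av => c3; apply/contains0111P.
  exists 0, v; split=> //=.
  have -> : [:: v; v; v] = take 3 (filter (pred1 v) w).
    have /all_pred1P -> := filter_all (pred1 v) w.
    by rewrite size_filter take_nseq.
  exact: subseq_trans (take_subseq _ _) (filter_subseq _ _).
apply/contains0111P => -[a [v [/= sub av]]].
have v0 : 0 < v by apply: leq_ltn_trans av.
have vvv : subseq [:: v; v; v] w.
  by move: sub; case: ifP => // _; apply: subseq_trans (subseq_cons _ _).
have := leq_count_subseq (pred1 v) vvv; have := cnt v v0.
by rewrite /= eqxx; lia.
Qed.

(** * Appending one letter *)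

Lemma count_rcons (T : eqType) (u v : T) s :
  count_mem u (rcons s v) = count_mem u s + (v == u).
Proof. by rewrite -cats1 count_cat /= addn0. Qed.

Lemma asc_rcons s v : asc (0 :: rcons s v) = asc (0 :: s) + (last 0 s < v).
Proof.
rewrite /asc /= size_rcons -addn1 iotaD count_cat /= addn0 add0n.
congr (_ + _); last first.
  by rewrite nth_rcons ltnn eqxx -rcons_cons nth_rcons /= ltnSn -last_nth.
apply: eq_in_count => i; rewrite mem_iota add0n /= => lti.
by rewrite -rcons_cons !nth_rcons /= lti ltnS (ltnW lti).
Qed.

Lemma ascent_seq_rcons s v :
  ascent_seq (0 :: rcons s v) = ascent_seq (0 :: s) && (v <= (asc (0 :: s)).+1).
Proof.
rewrite /ascent_seq /= size_rcons -[(size s).+1]addn1 iotaD all_cat /= andbT.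
congr (_ && _); last first.
  by rewrite /= nth_rcons ltnn eqxx addn1 -cats1 take_size_cat.
apply: eq_in_all => -[//|i]; rewrite mem_iota /= ltnS => lti.
by rewrite nth_rcons lti -cats1 takel_cat // ltnW.
Qed.

(* The leading 0 of a nonempty ascent sequence is left implicit from here on:
   [good s], [letters s] and [exts s n] are about the word [0 :: s]. *)
Definition good s := [&& ascent_seq (0 :: s), avoids (0 :: s) [:: 0; 2; 1]
                       & avoids (0 :: s) [:: 0; 1; 1; 1]].

(** For a good word this is the maximum, as its positive letters weakly increase; it is 0 when there
    are none. *)
Definition top s := last 0 (positives s).

(** What the two patterns demand of an appended letter; the ascent bound is imposed separately. *)
Definition extension s v := (v == 0) || (top s <= v) && (count_mem v s <= 1).

Lemma good_rcons s v :
  good (rcons s v) = [&& good s, v <= (asc (0 :: s)).+1 & extension s v].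
Proof.
have sortE : sorted leq (positives (rcons s v)) =
    sorted leq (positives s) && ((v == 0) || (top s <= v)).
  rewrite positives_rcons lt0n /top; case: eqP => [_|_] /=.
    by rewrite andbT.
  by case: (positives s) => //= p ps; rewrite rcons_path.
have countE : avoids (0 :: rcons s v) [:: 0; 1; 1; 1] =
    avoids (0 :: s) [:: 0; 1; 1; 1] && ((v == 0) || (count_mem v s <= 1)).
  apply/avoids0111P/andP => [cnt|[/avoids0111P cnt v1] z z0]; last first.
    have := cnt z z0; rewrite count_rcons; case: eqP => [vz|_]; last by rewrite addn0.
    by move: v1; rewrite vz (gtn_eqF z0) /=; lia.
  split; last first.
    by case: posnP => //= v0; have := cnt v v0; rewrite count_rcons eqxx addn1.
  by apply/avoids0111P => z z0; have := cnt z z0; rewrite count_rcons; lia.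
rewrite /good ascent_seq_rcons !avoids021E sortE countE /extension.
case: (ascent_seq _) => //=; case: (sorted _ _) => //=; last by rewrite !andbF.
case: (avoids _ _); case: (v == 0); case: (v <= _) => //=; by rewrite ?andbF.
Qed.

(** * Enumerating the extensions by [n] letters *)

Definition letters s := [seq v <- iota 0 (asc (0 :: s)).+2 | extension s v].

Fixpoint exts s n : seq (seq nat) :=
  if n is m.+1 then flatten [seq exts (rcons s v) m | v <- letters s]
  else [:: s].

Lemma mem_letters s v : good s -> (v \in letters s) = good (rcons s v).
Proof.
by move=> gs; rewrite good_rcons gs mem_filter mem_iota add0n ltnS andbC.
Qed.

Lemma good_cat s t : good (s ++ t) -> good s.
Proof.
elim/last_ind: t => [|t v IHt]; first by rewrite cats0.
by rewrite -rcons_cat good_rcons => /and3P[/IHt].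
Qed.

Lemma mem_exts s n a : good s ->
  (a \in exts s n) = [&& size a == size s + n, prefix s a & good a].
Proof.
elim: n s => [|n IHn] s gs.
  rewrite inE addn0; apply/eqP/and3P => [->|[/eqP sza /prefixP[t at_] _]].
    by rewrite prefix_refl.
  move: sza; rewrite at_ size_cat => /eqP.
  by rewrite -[X in _ == X]addn0 eqn_add2l size_eq0 => /eqP ->; rewrite cats0.
apply/idP/and3P => [/flatten_mapP[v vs ca]|[/eqP sza /prefixP[t at_] ga]].
  move: ca; rewrite mem_letters // in vs; rewrite IHn // size_rcons addSnnS.
  by move=> /and3P[-> pa ->]; split=> //; apply: prefix_trans (prefix_rcons _ _) pa.
case: t at_ => [|v t] at_.
  by move/eqP: sza; rewrite at_ cats0 -[X in X == _]addn0 eqn_add2l.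
have gsv : good (rcons s v).
  by apply: (@good_cat _ t); rewrite cat_rcons -at_.
apply/flatten_mapP; exists v; first by rewrite mem_letters.
rewrite IHn // sza size_rcons addSnnS eqxx ga andbT /=.
by rewrite at_ -cat_rcons prefix_prefix.
Qed.

(** Extensions through different next letters differ at position [size s], so the concatenated lists
    are disjoint. *)
Lemma exts_uniq s n : good s -> uniq (exts s n).
Proof.
elim: n s => [|n IHn] s gs //.
have -> : exts s n.+1 =
    [seq a | v <- letters s, a <- exts (rcons s v) n].
  by congr flatten; apply: eq_map => v; rewrite map_id.
apply: (@allpairs_uniq_dep _ (fun=> seq nat)); first by rewrite filter_uniq ?iota_uniq.
  by move=> v; rewrite mem_letters //; apply: IHn.
move=> _ _ /allpairsPdep[v [a [vs av ->]]] /allpairsPdep[w [c [ws cw ->]]] /= ac.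
move: av cw; rewrite -{}ac !mem_exts -?mem_letters //.
move=> /and3P[_ /prefixP[t ->] _] /and3P[_ pw _].
move: pw => /prefixP[t']; rewrite !cat_rcons => /eqP.
by rewrite eqseq_cat // eqxx /= eqseq_cons => /andP[/eqP -> _].
Qed.

Lemma good_nil : good [::].
Proof.
by rewrite /good avoids021E; apply/and3P; split=> //; apply/avoids0111P.
Qed.

Lemma b0 : b [:: 0; 1; 1; 1] 0 = 1.
Proof.
rewrite -(cardfs1 ([::] : seq nat)) /b; congr (#|` _|%fset).
apply/fsetP => a; rewrite in_fset_set; last exact: finite_B.
apply/idP/fset1P => [|->]; rewrite inE /B /=.
  by case=> /size0nil.
split=> //; apply/negP => /containsP[u].
  by rewrite subseq0 => /eqP -> [].
by rewrite subseq0 => /eqP -> [].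
Qed.

(** The leading 0 is forced; deleting it leaves an extension of the empty word by [n] letters. *)
Lemma b_exts n : b [:: 0; 1; 1; 1] n.+1 = size (exts [::] n).
Proof.
have g0 := good_nil.
set e := exts [::] n.
have -> : size e = size (map (cons 0) e) by rewrite size_map.
rewrite -(undup_id (s := map _ e)); last first.
  by rewrite map_inj_uniq ?exts_uniq // => ? ? [].
rewrite -card_fseq /b; congr (#|` _|%fset).
apply/fsetP => a; rewrite in_fset_set ?inE; last exact: finite_B.
apply/idP/mapP => [|[c ce ->]].
  rewrite inE /B /= => -[sza aP av1 av2].
  case: a sza aP av1 av2 => // a0 a [sza] aP.
  have a00 : a0 = 0 by move: aP => /andP[/eqP].
  rewrite a00 in aP *; move=> av1 av2; exists a => //.
  by rewrite mem_exts // sza eqxx prefix0s /good aP av1.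
move: ce; rewrite mem_exts // inE /B /= => /and3P[/eqP szc _ /and3P[]].
by rewrite /= szc.
Qed.

Lemma size_exts s n :
  size (exts s n.+1) = \sum_(v <- letters s) size (exts (rcons s v) n).
Proof. by rewrite size_flatten sumnE !big_map. Qed.

(** * The maximum of a good word *)

Lemma top_rcons s v : top (rcons s v) = if 0 < v then v else top s.
Proof. by rewrite /top positives_rcons; case: ifP; rewrite ?last_rcons. Qed.

Lemma last_top s : last 0 s != 0 -> last 0 s = top s.
Proof.
by case/lastP: s => // s v; rewrite last_rcons top_rcons lt0n => ->.
Qed.

Lemma top_max s v : good s -> v \in s -> v <= top s.
Proof.
elim/last_ind: s v => // s u IHs v; rewrite good_rcons => /and3P[gs _ eu].
rewrite mem_rcons inE top_rcons => /orP[/eqP ->|/(IHs _ gs) vs].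
  by case: posnP => // ->.
by move: eu; rewrite /extension; case: posnP => //= _ /andP[/(leq_trans vs)].
Qed.

Lemma top_mem s : 0 < top s -> top s \in s.
Proof.
rewrite /top => t0; have /mem_subseq : subseq (positives s) s by apply: filter_subseq.
by apply; case: (positives s) t0 => //= a p _; apply: mem_last.
Qed.

Lemma count_top_le2 s : good s -> 0 < top s -> count_mem (top s) s <= 2.
Proof. by case/and3P => _ _ /avoids0111P; apply. Qed.

Local Open Scope ring_scope.

(** * Coefficients of power series *)

Section FpsCoef.
Variable R : fieldType.
Implicit Types p q : fps R.

Lemma fps_coefM0 p q : (p * q) 0%N = p 0%N * q 0%N.
Proof. by rewrite fps_coefM big_ord1. Qed.

Lemma fps_coefX0 p n : (p ^+ n) 0%N = p 0%N ^+ n.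
Proof. by elim: n => [|n IHn]; rewrite ?expr0 // !exprS fps_coefM0 IHn. Qed.

Definition fps_coef0E :=
  (fps_coefD, fps_coefN, fps_coefM0, fps_coefX0).

Lemma fps_coefXM p n : (fpsX R * p) n = if n is m.+1 then p m else 0.
Proof.
case: n => [|n]; first by rewrite fps_coefM0 mul0r.
rewrite fps_coefM big_ord_recl big_ord_recl /= mul0r add0r mul1r.
by rewrite big1 ?addr0 ?subn1 // => i _; rewrite mul0r.
Qed.

Lemma fps_coefXnM p k n :
  (fpsX R ^+ k * p) n = if (n < k)%N then 0 else p (n - k)%N.
Proof.
elim: k n => [|k IHk] n; first by rewrite expr0 mul1r subn0.
by rewrite exprS -mulrA fps_coefXM; case: n => [|n] //; rewrite IHk.
Qed.

(** By strong induction: once the lower coefficients of [p] vanish, coefficient [i] of the product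
    is [p i * q 0]. *)
Lemma fps_coefXnM_eq0 p q r k : q 0%N != 0 -> p * q = fpsX R ^+ k * r ->
  forall i, (i < k)%N -> p i = 0.
Proof.
move=> q0 pq i; have [m] := ubnP i; elim: m i => // m IHm i ltim ltik.
have := congr1 (fun p : fps R => p i) pq.
rewrite fps_coefXnM ltik fps_coefM big_ord_recr /= subnn big1; last first.
  move=> j _; rewrite IHm ?mul0r //; last exact: ltn_trans ltik.
  exact: leq_trans (ltn_ord j) _.
by rewrite add0r => /eqP; rewrite mulf_eq0 (negbTE q0) orbF => /eqP.
Qed.

Lemma fps_factorXn p k : (forall i, (i < k)%N -> p i = 0) ->
  exists q, p = fpsX R ^+ k * q.
Proof.
move=> p0; exists (FPS (fun n => p (n + k)%N)); apply/fpsP => n.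
by rewrite fps_coefXnM; case: ltnP => [/p0|/subnK] /= ->.
Qed.

Lemma fps_coef_sum (I : Type) (r : seq I) (F : I -> fps R) n :
  (\sum_(i <- r) F i) n = \sum_(i <- r) F i n.
Proof. by elim/big_rec2: _ => // i x p _ <-. Qed.

Lemma fpsX_neq0 : fpsX R != 0.
Proof. by apply/eqP => /fpsP/(_ 1%N)/eqP; rewrite /= oner_eq0. Qed.

Lemma fps_natr_neq0 k : (k%:R : R) != 0 -> (k%:R : fps R) != 0.
Proof.
apply: contraNneq => k0.
have <- : (k%:R : fps R) 0%N = k%:R; last by rewrite k0.
by elim: k {k0} => // k IHk; rewrite !mulrS -IHk.
Qed.

End FpsCoef.

(** * The power series root of the quadratic equation *)

Local Notation x := (fpsX rat).
Local Notation sqrtD := (fps_sqrt (1 - 4%:R * x + 2%:R * x ^+ 2 + x ^+ 4)).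

(* The discriminant is [1 - 4 x + 2 x^2 + x^4 = (1 - 2 x - x^2)^2 - 4 x^3] *)
Lemma sqrt_root_exists : exists u : fps rat,
  u = 1 + (2%:R * x + x ^+ 2) * u + x ^+ 3 * u ^+ 2 /\
  2%:R * x ^+ 2 * (1 + x * u) = (1 - x) ^+ 2 - sqrtD.
Proof.
have nz2 : (2%:R : rat) != 0 by [].
set D := 1 - _ + _ + _.
have D0 : D 0%N = 1.
  by rewrite /D !fps_coef0E /=; ring.
have s0 := fps_sqrt0 D; have sD := fps_sqrtK nz2 D0.
move: (fps_sqrt D) s0 sD => s s0 sD.
pose q : fps rat := 1 - 2%:R * x - x ^+ 2.
have q0 : q 0%N = 1.
  by rewrite /q !fps_coef0E /=; ring.
have prod : (q - s) * (q + s) = x ^+ 3 * 4%:R.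
  by rewrite -subr_sqr sD /q /D; ring.
have e0 : (q + s) 0%N = 2%:R by rewrite fps_coefD q0 s0.
have coef0 i : (i < 3)%N -> (q - s) i = 0.
  (* The constant term of [q + s] is 2, so [x ^+ 3] divides the other factor [q - s]; the root is
     then [u = (q - s) / (2 x^3)]. *)
  by apply: (fps_coefXnM_eq0 _ prod); rewrite e0.
have [w qsw] := fps_factorXn coef0.
have [u wu] : exists u, w = 2%:R * u.
  exists (FPS (fun n => w n / 2%:R)); apply/fpsP => n.
  by rewrite mulr_natl mulr2n fps_coefD; apply: splitr.
have sE : s = q - x ^+ 3 * (2%:R * u) by rewrite -wu -qsw opprB addrC subrK.
exists u; split; last by rewrite sE /q; ring.
(* Multiplied by [4 x^3], the equation for [u] becomes [(q - s) (q + s) = 4 x^3]. *)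
have nz : x ^+ 3 * 4%:R != 0.
  by rewrite mulf_neq0 ?expf_neq0 ?fpsX_neq0 // fps_natr_neq0.
apply: (mulfI nz); rewrite -[X in _ = _ * (X + _ + _)]mulr1 -{1}[x ^+ 3 * 4%:R]mulr1.
apply/eqP; rewrite -subr_eq0; apply/eqP.
transitivity ((q - s) * (q + s) - x ^+ 3 * 4%:R); last by rewrite prod subrr.
by rewrite sE /q; ring.
Qed.

(** * Generating functions of the extensions *)

Section Counts.
Variable u : fps rat.
Hypothesis uE : u = 1 + (2%:R * x + x ^+ 2) * u + x ^+ 3 * u ^+ 2.

(* [spent]: the maximum can no longer be repeated; [fresh0] and [fresh]: it can,
   after a final 0 and after a nonzero final letter respectively. *)
Definition spent (t : nat) : fps rat := (1 - x) ^+ t * u ^+ t.+1.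
Definition fresh0 (t : nat) : fps rat := spent t * (1 + x * u).
Definition fresh (t : nat) : fps rat := spent t * (1 + x + x ^+ 2 * u).

(** The sum telescopes, because [x * fresh t.+1 = (1 - x) * (spent t.+1 - spent t)]. *)
Lemma sum_fresh t : x * \sum_(i < t.+1) fresh i = (1 - x) * spent t - 1.
Proof.
(* The equation for [u] gives its inverse, [1 - 2 x - x^2 - x^3 u]. *)
have step v : v = (v * u) * (1 - 2%:R * x - x ^+ 2 - x ^+ 3 * u).
  rewrite -mulrA -{1}[v]mulr1; congr (_ * _).
  by rewrite [X in X = _](_ : 1 = u - (2%:R * x + x ^+ 2) * u - x ^+ 3 * u ^+ 2);
    [ring | rewrite {1}uE; ring].
elim: t => [|t IHt].
  by rewrite big_ord1 /fresh /spent expr0 mul1r expr1 {3}(step 1); ring.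
rewrite big_ord_recr /= mulrDr IHt /fresh /spent.
have := step ((1 - x) ^+ t * u ^+ t.+1); rewrite !exprS => {1}->.
ring.
Qed.

(** In this and the next two recurrences, 1 counts the empty extension, the first term after [x] an
    appended 0, the sum the new maxima, and the middle term, if any, a repeated maximum. *)
Lemma spent_rec t :
  spent t = 1 + x * (spent t + \sum_(i < t.+1) fresh i).
Proof. by rewrite mulrDr sum_fresh; ring. Qed.

Lemma fresh0_rec t :
  fresh0 t = 1 + x * (fresh0 t + spent t.+1 + \sum_(i < t.+1) fresh i).
Proof. by rewrite mulrDr sum_fresh /fresh0 /spent !exprS; ring. Qed.

Lemma fresh_rec t :
  fresh t = 1 + x * (fresh0 t + spent t + \sum_(i < t.+1) fresh i).
Proof. by rewrite mulrDr sum_fresh /fresh /fresh0; ring. Qed.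
(** Here [t] stands for [asc - top]. A word without positive letters counts as spent: repeating its
    maximum is just appending 0. *)
Definition continuations s t : fps rat :=
  if (top s == 0)%N || (count_mem (top s) s == 2)%N then spent t
  else if last 0%N s == 0%N then fresh0 t else fresh t.

Lemma continuations_coef0 s t : continuations s t 0%N = 1.
Proof.
rewrite /continuations; case: ifP => _; last case: ifP => _.
- by rewrite spent_rec fps_coefD fps_coefXM addr0.
- by rewrite fresh0_rec fps_coefD fps_coefXM addr0.
- by rewrite fresh_rec fps_coefD fps_coefXM addr0.
Qed.

(** Induction on [n]: splitting by the next letter (0, the maximum, a new maximum) reproduces the
    recurrences. *)
Lemma size_exts_coef s t n : good s -> asc (0%N :: s) = (top s + t)%N ->
  (size (exts s n))%:R = continuations s t n.
Proof.
elim: n s t => [|n IHn] s t gs ascE; first by rewrite continuations_coef0.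
rewrite size_exts natr_sum /letters big_filter ascE.
set m := top s; set F := fun v => (size (exts (rcons s v) n))%:R : rat.
have gsv v : (v <= (asc (0%N :: s)).+1)%N -> extension s v -> good (rcons s v).
  by move=> va ev; rewrite good_rcons gs va.
have count_gt v : (m < v)%N -> count_mem v s = 0%N.
  by move=> mv; apply/count_memPn/negP => /(top_max gs); rewrite leqNgt mv.
have ext_gt v : (m < v)%N -> extension s v.
  by move=> mv; rewrite /extension count_gt // (ltnW mv) orbT.
have big_part : \sum_(m.+1 <= v < (m + t).+2 | extension s v) F v =
    \sum_(i < t.+1) fresh i n.
  rewrite big_nat_cond (eq_bigl (fun v => m.+1 <= v < (m + t).+2)%N); last first.
    by move=> v; apply: andb_idr => /andP[/ext_gt].
  rewrite -big_nat -addnS -addSn -{1}[m.+1]add0n big_addn addKn big_mkord.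
  (* A new maximum always makes an ascent, so the choice [t - i + m.+1] turns [t] into [i]. *)
  rewrite (reindex_inj rev_ord_inj); apply: eq_bigr => i _ /=.
  rewrite subSS /F (IHn _ i); last first.
  - rewrite asc_rcons top_rcons addn_gt0 orbT ascE.
    have lt_last : (last 0 s < t - i + m.+1)%N.
      have [->|/last_top ->] := eqVneq (last 0%N s) 0%N; rewrite -/m; lia.
    by rewrite lt_last -/m; have := ltn_ord i; lia.
  - by apply: gsv; rewrite ?ascE -/m; [have := ltn_ord i; lia|apply: ext_gt; lia].
  rewrite /continuations top_rcons addn_gt0 orbT last_rcons count_rcons eqxx.
  by rewrite count_gt ?addnS //; lia.
have zero_part : F 0%N = (if (m == 0)%N || (count_mem m s == 2)%N then spent t
                         else fresh0 t) n.
  rewrite /F (IHn _ t); last first.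
  - by rewrite asc_rcons top_rcons ltn0 addn0.
  - exact: gsv.
  rewrite /continuations top_rcons ltnn last_rcons eqxx count_rcons -/m.
  by rewrite [(0 == m)%N]eq_sym; case: (m == 0)%N; rewrite ?addn0.
(* Letters strictly between 0 and [m] are forbidden; the test [m != 0] keeps the letter 0 from being
   counted twice. *)
have -> : \sum_(v <- iota 0 (m + t).+2 | extension s v) F v =
   F 0%N + (if (m != 0)%N && (count_mem m s <= 1)%N then F m else 0)
     + \sum_(i < t.+1) fresh i n.
  rewrite -big_part -[(m + t).+2]subn0 -/(index_iota _ _).
  rewrite (big_cat_nat _ (n := m.+1)) //=; last by rewrite -addnS -addSn leq_addr.
  congr (_ + _); have [m0|m0] := posnP m.
    by rewrite m0 big_mkcond big_nat1 addr0.
  rewrite big_mkcond big_nat_recr //= -(prednK m0) big_nat_recl // prednK //=.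
  rewrite big_nat_cond big1 ?addr0 => [|v /andP[/andP[_ vm] _]].
    by rewrite /extension (gtn_eqF m0) -/m leqnn.
  by rewrite /extension -/m leqNgt -ltn_predRL vm.
rewrite zero_part /continuations -/m.
case: ifP => [sp|].
  have -> : (m != 0)%N && (count_mem m s <= 1)%N = false.
    by case/orP: sp => /eqP ->; rewrite // andbF.
  by rewrite addr0 [in RHS]spent_rec fps_coefD fps_coefXM add0r fps_coefD fps_coef_sum.
move/negbT; rewrite negb_or => /andP[m0 cm2].
have m_gt0 : (0 < m)%N by rewrite lt0n.
have cm1 : count_mem m s = 1%N.
  have := count_top_le2 gs m_gt0; have := top_mem m_gt0.
  by rewrite -has_pred1 has_count -/m; lia.
have ext_m : extension s m by rewrite /extension cm1 -/m leqnn orbT.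
rewrite m0 cm1 /=; set l := (last 0%N s == 0)%N.
(* The second copy of [m] exhausts it, and makes an ascent exactly when the last letter was 0: a
   nonzero last letter is [m] itself. *)
have -> : F m = spent (t + l) n.
  rewrite /F (IHn _ (t + l)%N); last first.
  - rewrite asc_rcons top_rcons m_gt0 ascE -/m -addnA /l; congr (_ + (_ + _))%N.
    by have [->|/last_top ->] := eqVneq (last 0%N s) 0%N; rewrite ?m_gt0 // ltnn.
  - by apply: gsv; rewrite // ascE -/m; lia.
  by rewrite /continuations top_rcons m_gt0 count_rcons cm1 eqxx orbT.
case: l; rewrite ?addn1 ?addn0.
  by rewrite [in RHS]fresh0_rec fps_coefD fps_coefXM add0r !fps_coefD fps_coef_sum.
by rewrite [in RHS]fresh_rec fps_coefD fps_coefXM add0r !fps_coefD fps_coef_sum.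
Qed.

End Counts.

Theorem theorem3p5 :
  let x : fps rat := fpsX rat in
  (genfun [:: 0; 1; 1; 1]%N)%:F =
  ((1 - x) ^+ 2 - fps_sqrt (1 - 4%:R * x + 2%:R * x ^+ 2 + x ^+ 4))%:F
    / (2%:R * x ^+ 2)%:F.
Proof.
move=> x; have [u [uE fE]] := sqrt_root_exists.
have -> : genfun [:: 0; 1; 1; 1]%N = 1 + x * u.
  apply/fpsP => -[|n]; rewrite fps_coefD fps_coefXM.
    by rewrite addr0 /= b0.
  (* The word 0 has no ascent and no positive letter, so its series is [spent u 0], that is [u]. *)
  rewrite add0r /= b_exts (size_exts_coef uE (t := 0%N)) ?good_nil //.
  by rewrite -[continuations u _ _]/(spent u 0) /spent expr0 mul1r.
rewrite -fE rmorphM /= mulrAC divff ?mul1r //.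
rewrite tofrac_eq0.
by rewrite mulf_neq0 ?expf_neq0 ?fpsX_neq0 // fps_natr_neq0.
Qed.
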